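(* Let $s,t\ge 3$ be integers, let $\varphi$ be a reflection of $C_t$, and let $G=C_s\Box^{\varphi}C_t$. Then $mbt(G)=4$ if $G$ is bipartite, and $mbt(G)=5$ otherwise.
   Context: The cycle $C_t$ has vertex set $\{1,\dots,t\}$ with $j$ adjacent to $j\pm 1$ (mod $t$). A reflection of $C_t$ is an automorphism of the form $j\mapsto c-j\pmod t$ for some integer $c$; it has exactly one fixed point if $t$ is odd, and either no or exactly two fixed points if $t$ is even. For an automorphism $\varphi$ of $C_t$, the Cartesian graph bundle $C_s\Box^{\varphi}C_t$ (fiber $C_t$ over base $C_s$, with $\varphi$ assigned to the base edge $\{s,1\}$ and the identity to all other base edges) is the graph with vertex set $\{(i,j):1\le i\le s,\ 1\le j\le t\}$ and edges: $(i,j)\sim(i,j+1)$ (second coordinate mod $t$) for all $i,j$; $(i,j)\sim(i+1,j)$ for $1\le i\le s-1$ and all $j$; and $(s,j)\sim(1,\varphi(j))$ for all $j$. A matching book embedding of a graph $G$ with $m$ pages consists of an arrangement of the vertices of $G$ in some cyclic order on a circle, with edges drawn as chords, together with a proper edge coloring with $m$ colors such that any two edges whose chords cross receive different colors. The matching book thickness $mbt(G)$ is the minimum $m$ for which such an embedding exists. *)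

(* Defs.v *)
From mathcomp Require Import all_boot all_order all_algebra all_fingroup.

Set Implicit Arguments.
Unset Strict Implicit.
Unset Printing Implicit Defensive.

(* A graph is a symmetric irreflexive relation on a finite type. *)

Definition bipartite (T : finType) (e : rel T) : Prop :=
  exists A : {set T}, forall u v : T, e u v -> (u \in A) != (v \in A).

Definition automorphism (T : finType) (e : rel T) (f : {perm T}) : Prop :=
  forall u v : T, e (f u) (f v) = e u v.

Definition edges (T : finType) (e : rel T) : {set {set T}} :=
  [set [set p.1; p.2] | p : T * T & e p.1 p.2].

Definition edge (T : finType) (e : rel T) : finType :=
  {f : {set T} | f \in edges e}.

(* A cyclic order is given by positions 0, ..., #|T| - 1 read along the circle
   from an arbitrary starting point; two chords cross iff their endpoints are
   distinct and alternate, which does not depend on that point. *)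
Definition alternate (T : finType) (pos : {ffun T -> 'I_#|T|})
    (f g : {set T}) : bool :=
  [exists a, exists b, exists c, exists d,
    [&& f == [set a; b], g == [set c; d],
        pos a < pos c, pos c < pos b & pos b < pos d]].

Definition cross (T : finType) (pos : {ffun T -> 'I_#|T|})
    (f g : {set T}) : bool :=
  alternate pos f g || alternate pos g f.

Definition proper_edge_coloring (T : finType) (e : rel T) (m : nat)
    (col : {ffun edge e -> 'I_m}) : bool :=
  [forall f : edge e, forall g : edge e,
    (f != g) && (val f :&: val g != set0) ==> (col f != col g)].

Definition matching_book_embedding (T : finType) (e : rel T) (m : nat)
    (pos : {ffun T -> 'I_#|T|}) (col : {ffun edge e -> 'I_m}) : bool :=
  [&& injectiveb pos, proper_edge_coloring col &
      [forall f : edge e, forall g : edge e,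
        cross pos (val f) (val g) ==> (col f != col g)]].

Definition has_matching_book_embedding (T : finType) (e : rel T) (m : nat) :
    bool :=
  [exists pos : {ffun T -> 'I_#|T|}, exists col : {ffun edge e -> 'I_m},
    matching_book_embedding pos col].

Lemma alternate_neq (T : finType) (pos : {ffun T -> 'I_#|T|})
    (f g : {set T}) : alternate pos f g -> f != g.
Proof.
case/existsP=> a /existsP[b /existsP[c /existsP[d]]].
case/and5P=> /eqP-> /eqP-> ac cb _; apply/eqP=> /setP/(_ c).
rewrite !inE eqxx /= => /orP[] /eqP cE; first by rewrite cE ltnn in ac.
by rewrite cE ltnn in cb.
Qed.

Lemma ex_matching_book_embedding (T : finType) (e : rel T) :
  exists m : nat, has_matching_book_embedding e m.
Proof.
exists #|edge e|; apply/existsP; exists [ffun u => enum_rank u].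
apply/existsP; exists [ffun f => enum_rank f].
apply/and3P; split.
- by apply/injectiveP=> u v; rewrite !ffunE => /enum_rank_inj.
- apply/forallP=> f; apply/forallP=> g; apply/implyP=> /andP[fg _].
  by rewrite !ffunE (inj_eq enum_rank_inj).
- apply/forallP=> f; apply/forallP=> g; apply/implyP=> fg.
  rewrite !ffunE (inj_eq enum_rank_inj) -val_eqE.
  by case/orP: fg => /alternate_neq //; rewrite eq_sym.
Qed.

Definition mbt (T : finType) (e : rel T) : nat :=
  ex_minn (ex_matching_book_embedding e).

(* Vertices 1, ..., t are represented by 0, ..., t - 1. *)
Definition cycle_graph (t : nat) : rel 'I_t :=
  fun j k => (j.+1 == k %[mod t]) || (k.+1 == j %[mod t]).

(* Shifting the labels by one replaces c by c - 2, so the family of maps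
   j |-> c - j is the same for the labels 0, ..., t - 1. *)
Definition reflection (t : nat) (phi : {perm 'I_t}) : Prop :=
  automorphism (@cycle_graph t) phi /\
  exists c : int, forall j : 'I_t, (Posz (phi j) = c - Posz j %[mod t])%Z.

Definition bundle_arc (s t : nat) (phi : {perm 'I_t}) : rel ('I_s * 'I_t) :=
  fun u v =>
    [|| (u.1 == v.1) && (u.2.+1 == v.2 %[mod t]),
        (u.1.+1 == v.1 :> nat) && (u.2 == v.2)
      | [&& u.1.+1 == s :> nat, v.1 == 0 :> nat & v.2 == phi u.2]].

Definition cycle_bundle (s t : nat) (phi : {perm 'I_t}) : rel ('I_s * 'I_t) :=
  fun u v => bundle_arc phi u v || bundle_arc phi v u.

Lemma cycle_bundle_sym (s t : nat) (phi : {perm 'I_t}) :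
  symmetric (@cycle_bundle s t phi).
Proof. by move=> u v; rewrite /cycle_bundle orbC. Qed.

Lemma cycle_bundle_irrefl (s t : nat) (phi : {perm 'I_t}) :
  2 < s -> 2 < t -> irreflexive (@cycle_bundle s t phi).
Proof.
move=> s_gt2 t_gt2 [i j]; rewrite /cycle_bundle orbb /bundle_arc /=.
rewrite eqxx -[j.+1]addn1 -[X in _ == X %[mod t]]addn0 eqn_modDl.
rewrite modn_small ?(ltn_trans _ t_gt2) // mod0n /= gtn_eqF //=.
by apply/negP=> /and3P[/eqP is_ /eqP i0 _]; rewrite -is_ i0 in s_gt2.
Qed.

(* Main.v *)
(* A colour appears at most once at each vertex and the graph is 4-regular, so 4
   colours are necessary.  With exactly 4 colours, each colour class is a
   noncrossing perfect matching; the vertices strictly between the ends of a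
   chord are matched among themselves, hence every edge joins positions of
   opposite parity and the graph is bipartite.

   For the upper bounds, let row i be the i-th fiber and column q the vertices
   with label q, the labels being rotated so that the reflection becomes
   q |-> t - 1 - q or q |-> -q.  If t is even, read the columns one after the
   other in alternating directions.  The edges between two consecutive columns
   are nested, and two colours alternate around the fiber; the edges inside a
   column join consecutive vertices, and two more colours suffice.  The edges
   over the last base edge join mirror-image columns, so that they are nested up
   to crossings inside each pair of columns; they fit in the two latter colours
   if the graph is bipartite, and in these and a fifth one otherwise.  If s and
   t are odd, read the rows in alternating directions instead.  If s is even and
   t odd, interleave columns 0 and 1, which makes the number of alternating
   blocks around the fiber even. *)

Require Import Defs.
From mathcomp Require Import all_boot all_order all_algebra all_fingroup.
From mathcomp Require Import zify.

Set Implicit Arguments.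
Unset Strict Implicit.
Unset Printing Implicit Defensive.

(** * Embeddings as linear orders with coloured relations *)

Lemma eq_set2 (T : finType) (a b c d : T) :
  [set a; b] = [set c; d] -> (a = c /\ b = d) \/ (a = d /\ b = c).
Proof.
move=> E; have := set21 a b; have := set22 a b.
have := set21 c d; have := set22 c d; rewrite -{1 2}E {3 4}E !inE.
by do 4![case/orP=> /eqP ?]; subst; auto.
Qed.

Lemma edgesP (T : finType) (e : rel T) (f : {set T}) :
  reflect (exists u v, e u v /\ f = [set u; v]) (f \in edges e).
Proof.
apply: (iffP imsetP) => [[[u v]]|[u [v [uv ->]]]].
  by rewrite inE /= => uv ->; exists u, v.
by exists (u, v); rewrite ?inE.
Qed.

(** The rank of a vertex under [lt] serves as its position. Colours come as a relation [R], from
    which one colour per edge is chosen, so that layouts never handle edges as sets. *)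
Lemma has_matching_book_embedding_of_order (T : finType) (e : rel T) (m : nat)
    (lt : rel T) (R : nat -> T -> T -> Prop) :
  irreflexive lt -> transitive lt ->
  (forall u v, u != v -> lt u v || lt v u) ->
  (forall k u v, R k u v -> R k v u) ->
  (forall u v, e u v -> exists2 k, k < m & R k u v) ->
  (forall k u v w, R k u v -> R k u w -> v = w) ->
  (forall k a b c d, R k a b -> R k c d -> lt a c -> lt c b -> lt b d ->
    False) ->
  has_matching_book_embedding e m.
Proof.
move=> lt_irr lt_trans lt_total R_sym R_cover R_proper R_nc.
have rankP u : #|[set v | lt v u]| < #|T|.
  rewrite -cardsT; apply/proper_card/properP; split; first exact: subsetT.
  by exists u; rewrite ?inE ?lt_irr.
pose pos := [ffun u => Ordinal (rankP u)].
have lt_pos u v : lt u v -> pos u < pos v.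
  move=> uv; rewrite !ffunE /=; apply/proper_card/properP; split.
    by apply/subsetP=> w; rewrite !inE => /lt_trans; apply.
  by exists u; rewrite !inE ?lt_irr.
have pos_lt u v : pos u < pos v -> lt u v.
  move=> uv; have [E|/lt_total/orP[//|/lt_pos]] := eqVneq u v.
    by rewrite E ltnn in uv.
  by rewrite ltnNge (ltnW uv).
have /fin_all_exists[col colP] (f : edge e) :
    exists k : 'I_m, exists u v, R k u v /\ val f = [set u; v].
  have /edgesP[u [v [/R_cover[k km Rk] ->]]] := valP f.
  by exists (Ordinal km), u, v.
apply/existsP; exists pos; apply/existsP; exists (finfun col).
have col_set (f : edge e) a b : val f = [set a; b] -> R (col f) a b.
  have [u [v [Rk ->]]] := colP f.
  by case/eq_set2=> -[<- <-] //; apply: R_sym.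
apply/and3P; split.
- apply/injectiveP=> u v E; apply/eqP/negPn/negP => /lt_total.
  by case/orP=> /lt_pos; rewrite E ltnn.
- apply/forallP=> f; apply/forallP=> g; apply/implyP=> /andP[fg].
  case/set0Pn=> x; rewrite inE => /andP[xf xg]; rewrite !ffunE.
  have edge_at (h : edge e) : x \in val h ->
      exists2 y, R (col h) x y & val h = [set x; y].
    have [u [v [Rk E]]] := colP h; rewrite E !inE.
    case/orP=> /eqP->; first by exists v.
    by exists u; [apply: R_sym|rewrite setUC].
  have [y Ry fE] := edge_at _ xf; have [z Rz gE] := edge_at _ xg.
  apply: contra fg => /eqP E; rewrite -val_eqE /= fE gE.
  by rewrite -E in Rz; rewrite (R_proper _ _ _ _ Ry Rz).
- apply/forallP=> f; apply/forallP=> g; apply/implyP; rewrite !ffunE.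
  have alt (h k : edge e) : alternate pos (val h) (val k) -> col h != col k.
    case/existsP=> a /existsP[b /existsP[c /existsP[d]]].
    case/and5P=> /eqP hE /eqP kE /pos_lt ac /pos_lt cb /pos_lt bd.
    apply/eqP=> E; have := col_set _ _ _ kE; rewrite -E => kR.
    exact: (R_nc _ _ _ _ _ (col_set _ _ _ hE) kR ac cb bd).
  by case/orP=> /alt //; rewrite eq_sym.
Qed.

Lemma matching_book_embedding_colour (T : finType) (e : rel T) (m : nat) :
  symmetric e -> has_matching_book_embedding e m ->
  exists (pos : T -> nat) (c : T -> T -> nat),
    [/\ injective pos,
        forall u v, c u v = c v u,
        forall u v, e u v -> c u v < m,
        forall u v w, e u v -> e u w -> c u v = c u w -> v = w
      & forall u v w x, e u v -> e w x -> pos u < pos w -> pos w < pos v ->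
          pos v < pos x -> c u v <> c w x].
Proof.
move=> e_sym /existsP[pos /existsP[col /and3P[/injectiveP pos_inj]]].
move=> /forallP proper /forallP nc.
(* Non-edges get the default colour 0; bounds, properness and noncrossing are claimed for edges
   only. *)
pose c u v := oapp (fun f : edge e => val (col f)) 0 (insub [set u; v]).
have cE u v : e u v -> exists2 f : edge e, val f = [set u; v] & c u v = col f.
  move=> uv; have uvE : [set u; v] \in edges e by apply/edgesP; exists u, v.
  by exists (exist (fun f => f \in edges e) _ uvE); rewrite // /c insubT.
exists (fun u => val (pos u)), c; split.
- by move=> u v /val_inj /pos_inj.
- by move=> u v; rewrite /c setUC.
- by move=> u v /cE[f _ ->].
- move=> u v w uv uw; have [f fE ->] := cE _ _ uv; have [g gE ->] := cE _ _ uw.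
  move=> /val_inj E; have /forallP/(_ g)/implyP := proper f.
  have [fg|fg] := eqVneq f g.
    by move: gE; rewrite -fg fE => /eq_set2[[]|[-> ->]].
  rewrite E eqxx fE gE /= => share; suff: false by [].
  by apply: share; apply/set0Pn; exists u; rewrite !inE eqxx.
- move=> u v w x uv wx uw wv vx.
  have [f fE ->] := cE _ _ uv; have [g gE ->] := cE _ _ wx => /val_inj E.
  have /forallP/(_ g)/implyP := nc f; rewrite E eqxx /= => crossing.
  suff: false by []; apply: crossing; apply/orP; left.
  apply/existsP; exists u; apply/existsP; exists v.
  apply/existsP; exists w; apply/existsP; exists x.
  by rewrite fE gE !eqxx uw wv vx.
Qed.

(** * Lower bounds by degree and parity *)

Lemma degree_le_matching_book_embedding (T : finType) (e : rel T) (m : nat)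
    (u : T) :
  symmetric e -> has_matching_book_embedding e m -> #|[set v | e u v]| <= m.
Proof.
move=> e_sym /(matching_book_embedding_colour e_sym).
move=> [pos [c [_ _ c_lt c_proper _]]].
rewrite cardE -(size_map (c u)) -(size_iota 0 m); apply: uniq_leq_size.
  rewrite map_inj_in_uniq ?enum_uniq // => v w; rewrite !mem_enum !inE.
  exact: c_proper.
by move=> _ /mapP[v + ->]; rewrite mem_enum inE mem_iota => /c_lt.
Qed.

(** [mu] exchanges [lo], the elements placed before their partners, with its complement in [S]. *)
Lemma even_card_involution (T : finType) (S : {set T}) (pos : T -> nat)
    (mu : T -> T) :
  {in S, forall w, [/\ mu w \in S, mu (mu w) = w & pos (mu w) != pos w]} ->
  ~~ odd #|S|.
Proof.
move=> muP; pose lo := [set w in S | pos w < pos (mu w)].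
have hiE : mu @: lo = S :\: lo.
  apply/setP=> w; rewrite !inE; apply/imsetP/andP => [[x]|[wlo wS]].
    rewrite inE => /andP[xS xlt ->]; have [-> -> _] := muP _ xS.
    by rewrite ltnNge (ltnW xlt).
  have [muS muK muN] := muP _ wS; exists (mu w) => //.
  by move: wlo; rewrite inE muS muK wS /= -leqNgt ltn_neqAle muN.
rewrite -(cardsID lo S) -hiE card_in_imset.
  rewrite (setIidPr _) ?addnn ?odd_double //.
  by apply/subsetP=> w; rewrite inE => /andP[].
move=> x y; rewrite !inE => /andP[xS _] /andP[yS _] E.
by have [_ <- _] := muP _ xS; rewrite E; have [_ -> _] := muP _ yS.
Qed.

Lemma bipartite_of_matching_book_embedding (T : finType) (e : rel T) (m : nat) :
  symmetric e -> irreflexive e -> (forall u, m <= #|[set v | e u v]|) ->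
  has_matching_book_embedding e m -> bipartite e.
Proof.
move=> e_sym e_irr deg /(matching_book_embedding_colour e_sym).
move=> [pos [c [pos_inj c_sym c_lt c_proper c_nc]]].
(* The colours at [u] are distinct, below [m] and at least [m] in number, so each of them occurs. *)
have partner k u : k < m -> exists v, e u v /\ c u v = k.
  move=> km; pose nb := enum [set v | e u v].
  have nb_uniq : uniq (map (c u) nb).
    rewrite map_inj_in_uniq ?enum_uniq // => v w; rewrite !mem_enum !inE.
    exact: c_proper.
  have nb_sub : {subset map (c u) nb <= iota 0 m}.
    by move=> _ /mapP[v + ->]; rewrite mem_enum inE mem_iota => /c_lt.
  have [|_ /(_ k)] := uniq_min_size nb_uniq nb_sub.
    by rewrite size_map size_iota -cardE.
  rewrite mem_iota /= add0n km => /mapP[v]; rewrite mem_enum inE => uv ->.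
  by exists v.
pose below u := [set w | pos w < pos u].
exists [set u | odd #|below u|].
have main u v : pos u < pos v -> e u v -> odd #|below u| != odd #|below v|.
  move=> uv_lt uv; have [mu muP] := fin_all_exists (partner _ ^~ (c_lt _ _ uv)).
  have muK w : mu (mu w) = w.
    have [e1 c1] := muP w; have [e2 c2] := muP (mu w).
    rewrite e_sym in e1; apply: (c_proper _ _ _ e2 e1).
    by rewrite c2 -c1 c_sym.
  have mu_u : mu u = v by have [e1 c1] := muP u; apply: (c_proper u).
  pose S := [set w | pos u < pos w < pos v].
  have S_even : ~~ odd #|S|.
    apply: (@even_card_involution _ _ pos mu) => w.
    rewrite !inE => /andP[uw wv].
    have [e1 c1] := muP w; split=> //; last first.
      by apply/eqP=> /pos_inj E; rewrite E e_irr in e1.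
    (* The partner of [w] is neither end, as [mu] swaps [u] and [v]; outside the interval it would
       give a chord crossing [uv] in the same colour. *)
    apply/andP; split; rewrite ltnNge leq_eqVlt;
      apply/negP=> /orP[/eqP/pos_inj E|lt].
    - by rewrite -(muK w) E mu_u ltnn in wv.
    - by apply: (c_nc (mu w) w u v) => //; rewrite 1?e_sym // c_sym.
    - by rewrite -(muK w) -E -mu_u muK ltnn in uw.
    - exact: (c_nc u v w (mu w)).
  have -> : below v = below u :|: (u |: S).
    apply/setP=> w; rewrite !inE; have [->|wu] := eqVneq w u.
      by rewrite uv_lt orbT.
    have : pos w != pos u by apply: contra wu => /eqP/pos_inj->.
    by lia.
  rewrite cardsU cardsU1 (_ : below u :&: _ = set0) ?cards0 ?subn0.
    by rewrite !inE ltnn /= oddD oddD /= (negPf S_even); case: odd.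
  by apply/setP=> w; rewrite !inE; have [->|_] := eqVneq w u; lia.
move=> u v uv; rewrite !inE; have [lt|lt|/pos_inj E] := ltngtP (pos u) (pos v).
- exact: main.
- by rewrite eq_sym; apply: main; rewrite // e_sym.
- by rewrite E e_irr in uv.
Qed.

(** * Reduction of the bundle to a labelled grid *)

(** Edges are named by natural-number coordinates, which turns later case analyses into linear
    arithmetic. [LastFiber] closes a fiber; [LastBase] lies over the twisted base edge. *)
Inductive grid_edge :=
  Fiber of nat & nat | LastFiber of nat
| Base of nat & nat | LastBase of nat.

Definition valid (s t : nat) (x : grid_edge) : Prop :=
  match x with
  | Fiber i q => i < s /\ q.+1 < t
  | LastFiber i => i < s
  | Base i q => i.+1 < s /\ q < t
  | LastBase q => q < t
  end.

Definition source (s t : nat) (x : grid_edge) : nat * nat :=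
  match x with
  | Fiber i q | Base i q => (i, q)
  | LastFiber i => (i, t.-1)
  | LastBase q => (s.-1, q)
  end.

Definition target (psi : nat -> nat) (x : grid_edge) : nat * nat :=
  match x with
  | Fiber i q => (i, q.+1)
  | LastFiber i => (i, 0)
  | Base i q => (i.+1, q)
  | LastBase q => (0, psi q)
  end.

Definition joins (s t : nat) (psi : nat -> nat) (x : grid_edge)
    (u v : nat * nat) : Prop :=
  (u = source s t x /\ v = target psi x) \/
  (u = target psi x /\ v = source s t x).

Definition proper_grid (s t : nat) (psi : nat -> nat) (col : grid_edge -> nat) :
    Prop :=
  forall x y u v w, valid s t x -> valid s t y -> col x = col y ->
    joins s t psi x u v -> joins s t psi y u w -> x = y.

Definition noncrossing_grid (s t : nat) (psi : nat -> nat)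
    (lt : nat * nat -> nat * nat -> Prop) (col : grid_edge -> nat) : Prop :=
  forall x y a b c d, valid s t x -> valid s t y -> col x = col y ->
    joins s t psi x a b -> joins s t psi y c d ->
    lt a c -> lt c b -> lt b d -> False.

Lemma noncrossing_weaken (s t : nat) (psi : nat -> nat)
    (lt lt' : nat * nat -> nat * nat -> Prop) (col : grid_edge -> nat) :
  (forall u v, lt u v -> lt' u v) ->
  noncrossing_grid s t psi lt' col -> noncrossing_grid s t psi lt col.
Proof.
move=> sub nc x y a b c d vx vy e jx jy /sub ac /sub cb /sub bd.
exact: (nc x y a b c d).
Qed.

(** Rotation of the labels: addition modulo [t] for [j < t] and [r <= t]. *)
Definition shift (t r j : nat) : nat := if j + r < t then j + r else j + r - t.

(** Evaluating at label 0 shows that the constant of the reflection is [phi o] modulo [t]; all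
    labels being below [t], the congruence becomes an equality. *)
Lemma reflectionE (t : nat) (phi : {perm 'I_t}) (o j : 'I_t) :
  reflection phi -> o = 0 :> nat ->
  phi j = (if j <= phi o then phi o - j else t + phi o - j) :> nat.
Proof.
move=> [_ [c phiE]] o0; have := phiE j; have := phiE o; rewrite o0.
have := ltn_ord j; have := ltn_ord (phi j); have := ltn_ord (phi o).
set x := nat_of_ord (phi j); set y := nat_of_ord (phi o) => yt xt jt yE xE.
have : (Posz (x + j) == Posz y %[mod t])%Z.
  rewrite PoszD -intdiv.modzDml xE intdiv.modzDml yE.
  by rewrite GRing.subrK GRing.subr0.
rewrite !intdiv.modz_nat eqz_nat {xE yE phiE}.
have [lt|ge] := ltnP (x + j) t.
  by rewrite !modn_small // => /eqP<-; rewrite leq_addl addnK.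
rewrite -(subnK ge) modnDr !modn_small //; last by lia.
by move=> /eqP E; rewrite leqNgt ifN; lia.
Qed.

Lemma bundle_arcP (s t : nat) (phi : {perm 'I_t}) (psi : nat -> nat) (r : nat)
    (u v : 'I_s * 'I_t) :
  2 < t -> r <= t -> (forall j : 'I_t, psi (shift t r j) = shift t r (phi j)) ->
  bundle_arc phi u v ->
  exists x, [/\ valid s t x, (u.1 : nat, shift t r u.2) = source s t x
              & (v.1 : nat, shift t r v.2) = target psi x].
Proof.
case: u v => [i j] [i' j'] t3 rt psiE; rewrite /bundle_arc /=.
have := ltn_ord i; have := ltn_ord j; have := ltn_ord j' => j't jt it.
case/or3P=> [/andP[/eqP<- E]|/andP[/eqP iE /eqP<-]|].
- have : j' = (if j.+1 < t then j.+1 else 0) :> nat.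
    move: E; case: ltnP => h; first by rewrite !modn_small // => /eqP.
    have -> : j.+1 = t by lia.
    by rewrite modnn modn_small // => /eqP.
  move=> E'; have [h|h] := ltnP (shift t r j).+1 t.
    exists (Fiber i (shift t r j)); split=> //=; congr pair.
    by move: E' h; rewrite /shift; do !case: ifP; lia.
  exists (LastFiber i); split=> //=; congr pair;
    by move: E' h; rewrite /shift; do !case: ifP; lia.
- exists (Base i (shift t r j)); rewrite /= iE; split=> //; split=> //.
  by rewrite /shift; case: ifP; lia.
- case/and3P=> [/eqP iE /eqP-> /eqP->].
  exists (LastBase (shift t r j)); split=> /=; last by rewrite psiE.
    by rewrite /shift; case: ifP; lia.
  by congr pair; lia.
Qed.

Lemma bundle_embedding (s t m : nat) (phi : {perm 'I_t}) (psi : nat -> nat)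
    (r : nat) (lt : rel (nat * nat)) (col : grid_edge -> nat) :
  2 < t -> r <= t -> (forall j : 'I_t, psi (shift t r j) = shift t r (phi j)) ->
  irreflexive lt -> transitive lt ->
  (forall u v, u != v -> lt u v || lt v u) ->
  (forall x, col x < m) -> proper_grid s t psi col ->
  noncrossing_grid s t psi lt col ->
  has_matching_book_embedding (@cycle_bundle s t phi) m.
Proof.
move=> t3 rt psiE lt_irr lt_trans lt_total col_lt col_proper col_nc.
pose lab (u : 'I_s * 'I_t) := (u.1 : nat, shift t r u.2).
have lab_inj : injective lab.
  move=> [i j] [i' j'] [/val_inj-> E]; congr pair; apply: val_inj => /=.
  have := ltn_ord j; have := ltn_ord j'; move: E.
  by rewrite /shift; do !case: ifP; lia.
pose R k u v := exists x,
  [/\ valid s t x, col x = k & joins s t psi x (lab u) (lab v)].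
apply: (@has_matching_book_embedding_of_order _ _ _ (relpre lab lt) R).
- by move=> u; apply: lt_irr.
- by move=> v u w; apply: lt_trans.
- by move=> u v uv; apply: lt_total; rewrite (inj_eq lab_inj).
- by move=> k u v [x [vx cx [[]|[]]]] *; exists x; split=> //; [right|left].
- move=> u v /orP[] /(bundle_arcP t3 rt psiE)[x [vx tx hx]];
    exists (col x) => //; exists x; split=> //; first by left.
  by right.
- move=> k u v w [x [vx <- jx]] [y [vy cy jy]]; apply: lab_inj.
  have xy := col_proper _ _ _ _ _ vx vy (esym cy) jx jy.
  by move: jx jy; rewrite -xy => -[[-> ->]|[-> ->]] [[? ->]|[? ->]].
- move=> k a b c d [x [vx <- jx]] [y [vy cy jy]].
  exact: (col_nc _ _ _ _ _ _ vx vy (esym cy) jx jy).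
Qed.

(** * Bipartite bundles *)

Lemma ordSE (n : nat) (i : 'I_n) :
  ordS i = (if i.+1 == n then 0 else i.+1) :> nat.
Proof.
rewrite /=; case: eqP => [->|]; first exact: modnn.
by move=> h; rewrite modn_small //; have := ltn_ord i; lia.
Qed.

Lemma ord_predE (n : nat) (i : 'I_n) :
  ord_pred i = (if i == 0 :> nat then n.-1 else i.-1) :> nat.
Proof.
have := ltn_ord i; rewrite /=; case: eqP => [->|i0] lt.
  by rewrite modn_small; lia.
by rewrite (_ : (i + n).-1 = i.-1 + n); rewrite ?modnDr ?modn_small; lia.
Qed.

Lemma cycle_bundle_degree (s t : nat) (phi : {perm 'I_t}) (u : 'I_s * 'I_t) :
  2 < s -> 2 < t -> 4 <= #|[set v | cycle_bundle phi u v]|.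
Proof.
case: u => i j s3 t3.
(* Passing the twisted base edge applies [phi] forwards and its inverse backwards. *)
pose next := (ordS i, if i.+1 == s then phi j else j).
pose prev := (ord_pred i, if i == 0 :> nat then (phi^-1)%g j else j).
pose nb := [:: (i, ordS j); (i, ord_pred j); next; prev].
have neq n (k : 'I_n) : 2 < n ->
    [/\ ordS k != k, ord_pred k != k & ordS k != ord_pred k].
  move=> n3; have := ltn_ord k; rewrite -!(inj_eq (@ord_inj n)) ordSE ord_predE.
  by split; do !case: ifP; lia.
have [Si Pi SPi] := neq _ i s3; have [_ _ SPj] := neq _ j t3.
have nb_uniq : uniq nb.
  rewrite /= !inE /next /prev !xpair_eqE !eqxx /= (negPf SPj) (negPf SPi).
  by rewrite ![i == _]eq_sym (negPf Si) (negPf Pi).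
rewrite -[4]/(size nb) cardE; apply: uniq_leq_size => // v.
rewrite !inE mem_enum inE /cycle_bundle /bundle_arc.
have := ltn_ord i; have := ltn_ord j => jt it.
case/or4P=> /eqP-> /=.
- by rewrite eqxx modn_mod eqxx.
- rewrite eqxx /= orbC (_ : _ == _ %[mod t]) ?orbT //.
  rewrite [X in X.+1]ord_predE; apply/eqP.
  case: eqP => [->|?]; last by congr (_ %% _); lia.
  by rewrite (_ : t.-1.+1 = t) ?modnn ?mod0n; lia.
- have [iE|iN] := eqVneq i.+1 s; first by rewrite iE modnn !eqxx !orbT.
  have -> : i.+1 %% s = i.+1 by rewrite modn_small; lia.
  by rewrite !eqxx orbT.
- have [i0|iN] := eqVneq (i : nat) 0.
    have -> : (i + s).-1 %% s = s.-1 by rewrite i0 modn_small; lia.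
    by rewrite permKV (_ : s.-1.+1 == s) ?eqxx ?orbT; lia.
  have -> : (i + s).-1 %% s = i.-1.
    by rewrite (_ : (i + s).-1 = i.-1 + s) ?modnDr ?modn_small; lia.
  by rewrite (_ : i.-1.+1 == i) ?eqxx ?orbT; lia.
Qed.

(** Without closing edges the side of [(i, j)] is forced by the parity of [i + j]. The closing edge
    of fiber 0 then gives the parity of [t], and the twisted edge at label 0 that of [s]. *)
Lemma bipartite_cycle_bundle (s t : nat) (phi : {perm 'I_t}) (o : 'I_t) :
  2 < s -> 2 < t -> o = 0 :> nat -> bipartite (@cycle_bundle s t phi) ->
  ~~ odd t /\ odd s = odd (phi o).
Proof.
move=> s3 t3 o0 [A Aflip].
have s_gt0 : 0 < s by lia.
pose base := Ordinal s_gt0.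
have arcA u v : bundle_arc phi u v -> (v \in A) = ~~ (u \in A).
  move=> uv; have : cycle_bundle phi u v by rewrite /cycle_bundle uv.
  by move/Aflip; do 2!case: (_ \in A).
have parity n (u : 'I_s * 'I_t) :
    u.1 + u.2 = n -> (u \in A) = ((base, o) \in A) (+) odd n.
  elim: n u => [|n IHn] [i j] /= E.
    rewrite addbF; congr (_ \in A).
    by congr pair; apply: val_inj => /=; lia.
  have := ltn_ord i; have := ltn_ord j => jt it.
  have [j0|j_gt0] := posnP j.
    have i'P : i.-1 < s by lia.
    have arc_ij : bundle_arc phi (Ordinal i'P, j) (i, j).
      by rewrite /bundle_arc /= eqxx (_ : i.-1.+1 == i) ?orbT; lia.
    by rewrite (arcA _ _ arc_ij) (IHn (Ordinal i'P, j)) -?addbN //=; lia.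
  have j'P : j.-1 < t by lia.
  have arc_ij : bundle_arc phi (i, Ordinal j'P) (i, j).
    by rewrite /bundle_arc /= eqxx (_ : j.-1.+1 = j) ?eqxx; lia.
  by rewrite (arcA _ _ arc_ij) (IHn (i, Ordinal j'P)) -?addbN //=; lia.
have tP : t.-1 < t by lia.
have sP : s.-1 < s by lia.
split.
  have : bundle_arc phi (base, Ordinal tP) (base, o).
    by rewrite /bundle_arc /= o0 (_ : t.-1.+1 = t) ?modnn ?mod0n ?eqxx; lia.
  move/arcA; rewrite (parity t.-1 (base, Ordinal tP)) //= -addbN.
  by case: (_ \in A) => /=; lia.
have : bundle_arc phi (Ordinal sP, o) (base, phi o).
  by rewrite /bundle_arc /= (_ : s.-1.+1 = s) ?eqxx ?orbT; lia.
move/arcA; rewrite (parity s.-1 (Ordinal sP, o)) /= ?o0 ?addn0 //.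
rewrite (parity (phi o) (base, phi o)) //=.
by case: (_ \in A) => /=; lia.
Qed.

(** * The layouts *)

(* The reflection read in the labels, once these are rotated suitably. *)
Definition mirror0 (t q : nat) : nat := if q == 0 then 0 else t - q.
Definition mirror1 (t q : nat) : nat := t.-1 - q.

(** Rotating by [r] turns [c - j] into [c + 2r - q], so [c + 2r] must vanish modulo [t], where
    [c = phi o]. *)
Lemma mirror0_shift (t : nat) (phi : {perm 'I_t}) (o : 'I_t) :
  reflection phi -> o = 0 :> nat -> odd t || ~~ odd (phi o) ->
  exists2 r, r <= t & forall j : 'I_t,
    mirror0 t (shift t r j) = shift t r (phi j).
Proof.
move=> hphi o0 par; have := ltn_ord (phi o) => ot.
have [r rE] : exists r, phi o + r.*2 = t \/ phi o + r.*2 = t.*2.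
  (* Of [t] and [2t], the one with the parity of [phi o] is aimed at. *)
  exists (if odd (phi o) == odd t then (t - phi o)./2
          else (t.*2 - phi o)./2).
  by case: ifP; lia.
exists r => [|j]; first by lia.
have := ltn_ord j; rewrite (reflectionE j hphi o0) /mirror0 /shift {par}.
by case: (leqP j (phi o)); do !case: ifP; lia.
Qed.

(** Here the rotated constant must be [-1]: [phi o + 2r + 1] vanishes modulo [t]. *)
Lemma mirror1_shift (t : nat) (phi : {perm 'I_t}) (o : 'I_t) :
  reflection phi -> o = 0 :> nat -> odd t || odd (phi o) ->
  exists2 r, r <= t & forall j : 'I_t,
    mirror1 t (shift t r j) = shift t r (phi j).
Proof.
move=> hphi o0 par; have := ltn_ord (phi o) => ot.
have [r rE] : exists r, (phi o + r.*2).+1 = t \/ (phi o + r.*2).+1 = t.*2.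
  exists (if odd (phi o) == odd t then (t.*2.-1 - phi o)./2
          else (t.-1 - phi o)./2).
  by case: ifP; lia.
exists r => [|j]; first by lia.
have := ltn_ord j; rewrite (reflectionE j hphi o0) /mirror1 /shift {par}.
by case: (leqP j (phi o)); do !case: ifP; lia.
Qed.

(* Lines k are read one after the other, in alternating directions. *)
Definition boustrophedon (k x l y : nat) : bool :=
  (k < l) || (k == l) && (if odd k then y < x else x < y).

Definition by_column (u v : nat * nat) : bool :=
  boustrophedon u.2 u.1 v.2 v.1.

Definition by_row (u v : nat * nat) : bool := boustrophedon u.1 u.2 v.1 v.2.

(* Columns 0 and 1 come first, read together row by row as a ladder; since the
   ladder counts for one column, the directions of the others are swapped. *)
Definition ladder_first (u v : nat * nat) : bool :=
  if u.2 < 2 then (1 < v.2) || by_row u v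
  else (1 < v.2) && boustrophedon u.2 v.1 v.2 u.1.

(** A form of the order free of conditionals, suited to [lia]. *)
Definition boustrophedon_prop (k x l y : nat) : Prop :=
  k < l \/ (k = l /\ (odd k /\ y < x \/ ~~ odd k /\ x < y)).

Definition ladder_first_prop (u v : nat * nat) : Prop :=
  (u.2 < 2 /\ (1 < v.2 \/ boustrophedon_prop u.1 u.2 v.1 v.2)) \/
  (1 < u.2 /\ 1 < v.2 /\ boustrophedon_prop u.2 v.1 v.2 u.1).

Lemma boustrophedonP (k x l y : nat) :
  reflect (boustrophedon_prop k x l y) (boustrophedon k x l y).
Proof.
apply: (iffP idP); rewrite /boustrophedon /boustrophedon_prop;
  by case: (odd k); lia.
Qed.

Lemma by_columnW (u v : nat * nat) :
  by_column u v -> boustrophedon_prop u.2 u.1 v.2 v.1.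
Proof. by move/boustrophedonP. Qed.

Lemma by_rowW (u v : nat * nat) :
  by_row u v -> boustrophedon_prop u.1 u.2 v.1 v.2.
Proof. by move/boustrophedonP. Qed.

Lemma ladder_firstP (u v : nat * nat) :
  reflect (ladder_first_prop u v) (ladder_first u v).
Proof.
rewrite /ladder_first /ladder_first_prop; case: ltnP => h.
  apply: (iffP orP) => [[v1|/boustrophedonP uv]|[[_ [v1|uv]]|[]//]].
  - by left; split; [|left].
  - by left; split; [|right].
  - by left.
  - by right; apply/boustrophedonP.
apply: (iffP andP) => [[v1 /boustrophedonP uv]|[[]//|[_ [v1 uv]]]].
  by right.
by split=> //; apply/boustrophedonP.
Qed.

Lemma ladder_firstW (u v : nat * nat) :
  ladder_first u v -> ladder_first_prop u v.
Proof. by move/ladder_firstP. Qed.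

Lemma by_column_order :
  [/\ irreflexive by_column, transitive by_column
    & forall u v, u != v -> by_column u v || by_column v u].
Proof.
split=> [[i q]|[i q] [j p] [k l]|[i q] [j p]]; rewrite ?xpair_eqE.
- by apply/negP=> /by_columnW; rewrite /boustrophedon_prop /=; lia.
- move=> /by_columnW + /by_columnW + ; rewrite /boustrophedon_prop /= => h1 h2.
  by apply/boustrophedonP; rewrite /boustrophedon_prop /=; lia.
- rewrite /by_column /= => h; case: boustrophedonP => //= h1.
  by apply/boustrophedonP; move: h1; rewrite /boustrophedon_prop; lia.
Qed.

Lemma by_row_order :
  [/\ irreflexive by_row, transitive by_row
    & forall u v, u != v -> by_row u v || by_row v u].
Proof.
have [irr trans total] := by_column_order.
pose swap (u : nat * nat) := (u.2, u.1).
split=> [u|v u w|u v uv]; first exact: (irr (swap u)).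
  exact: (trans (swap v) (swap u) (swap w)).
apply: (total (swap u) (swap v)); apply: contra uv.
by case: u v => [? ?] [? ?]; rewrite !xpair_eqE andbC.
Qed.

Lemma ladder_first_order :
  [/\ irreflexive ladder_first, transitive ladder_first
    & forall u v, u != v -> ladder_first u v || ladder_first v u].
Proof.
split=> [[i q]|[i q] [j p] [k l]|[i q] [j p]]; rewrite ?xpair_eqE.
- apply/negP=> /ladder_firstW.
  by rewrite /ladder_first_prop /boustrophedon_prop /=; lia.
- move=> /ladder_firstW + /ladder_firstW +.
  rewrite /ladder_first_prop /boustrophedon_prop /= => h1 h2.
  apply/ladder_firstP; rewrite /ladder_first_prop /boustrophedon_prop /=; lia.
- move=> h; case: (ladder_firstP (i, q) (j, p)) => //= h1.
  apply/ladder_firstP; move: h1.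
  by rewrite /ladder_first_prop /boustrophedon_prop /=; lia.
Qed.

(** For [s] even, the base edges at rows 0 and [s - 1] all have colour 2, so 3 is free for the
    twisted edges. For [s] odd, row [s - 1] already uses 3, whence colour 4. *)
Definition column_colour0 (s t : nat) (x : grid_edge) : nat :=
  match x with
  | Fiber i q => odd q
  | LastFiber i => 1
  | Base i q => 2 + odd i
  | LastBase q => 3 + odd s
  end.

(** Columns [q] and [t - 1 - q] run in opposite directions, so their two twisted edges cross and are
    coloured by halves of the fiber. For [s] odd, swapping 2 and 3 on the base edges of the upper
    half frees the same colour at both ends of each twisted edge. *)
Definition column_colour1 (s t : nat) (x : grid_edge) : nat :=
  match x with
  | Fiber i q => odd q
  | LastFiber i => 1
  | Base i q => if odd s && (t <= q.*2) then 3 - odd i else 2 + odd i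
  | LastBase q => (if odd s then 2 else 3) + (t <= q.*2)
  end.

(** [LastFiber i] spans row [i]. In rows 0 and [s - 1] the twisted edges occupy colour 4, so it
    takes the base colour absent from that row, [s] being odd. *)
Definition row_colour (s t : nat) (x : grid_edge) : nat :=
  match x with
  | Fiber i q => 2 + odd q
  | LastFiber i => if i == 0 then 1 else if i.+1 == s then 0 else 4
  | Base i q => odd i
  | LastBase q => 4
  end.

(* The long edges recoloured at the rows 0 and s - 1 free the colours needed by
   the rungs of the ladder in the rows 0, s - 2 and s - 1. *)
Definition ladder_colour (s t : nat) (x : grid_edge) : nat :=
  match x with
  | Fiber i q =>
      if odd q then 3
      else if (0 < q) || (i == 0) || (i.+1 == s) then 4
      else if i.+2 == s then 1 else 2
  | LastFiber i => if i == 0 then 2 else if i.+1 == s then 1 else 4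
  | Base i q =>
      if 1 < q then nat_of_bool (odd i)
      else if i.+2 == s then 2 else 1 - odd i
  | LastBase q => if q == 0 then 0 else 1 + (t <= q.*2)
  end.

Ltac split_if := repeat match goal with
  | |- context [if ?b then _ else _] =>
      lazymatch b with
      | context [if _ then _ else _] => fail
      | _ => destruct b eqn:?
      end
  end.

Ltac colour_cases :=
  rewrite /joins;
  cbn [source target valid column_colour0 column_colour1 row_colour
    ladder_colour];
  move=> vx vy; split_if; move=> same_colour; try (exfalso; lia);
  rewrite /mirror0 /mirror1.

Ltac prove_proper :=
  move=> [i q|i|i q|q] [j p|j|j p|p] u v w; colour_cases;
  move=> [[-> _]|[-> _]] [[/eqP + _]|[/eqP + _]]; rewrite xpair_eqE;
  split_if; intro; try (exfalso; lia); f_equal; lia.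

(** Each pair of edge kinds, in each orientation, reduces to inequalities and parities. *)
Ltac prove_noncrossing W :=
  apply: (noncrossing_weaken W);
  move=> [i q|i|i q|q] [j p|j|j p|p] a b c d; colour_cases;
  move=> [[-> ->]|[-> ->]] [[-> ->]|[-> ->]];
  rewrite /ladder_first_prop /boustrophedon_prop; cbn [fst snd];
  split_if; cbn [fst snd]; lia.

Lemma column_colour0_proper (s t : nat) :
  2 < s -> 2 < t -> ~~ odd t ->
  proper_grid s t (mirror0 t) (column_colour0 s t).
Proof. by move=> s3 t3 t_even; prove_proper. Qed.

Lemma column_colour0_noncrossing (s t : nat) :
  2 < s -> 2 < t -> ~~ odd t ->
  noncrossing_grid s t (mirror0 t) by_column (column_colour0 s t).
Proof. by move=> s3 t3 t_even; prove_noncrossing by_columnW. Qed.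

Lemma column_colour1_proper (s t : nat) :
  2 < s -> 2 < t -> ~~ odd t ->
  proper_grid s t (mirror1 t) (column_colour1 s t).
Proof. by move=> s3 t3 t_even; prove_proper. Qed.

Lemma column_colour1_noncrossing (s t : nat) :
  2 < s -> 2 < t -> ~~ odd t ->
  noncrossing_grid s t (mirror1 t) by_column (column_colour1 s t).
Proof. by move=> s3 t3 t_even; prove_noncrossing by_columnW. Qed.

Lemma row_colour_proper (s t : nat) :
  2 < s -> 2 < t -> odd s -> odd t ->
  proper_grid s t (mirror1 t) (row_colour s t).
Proof. by move=> s3 t3 s_odd t_odd; prove_proper. Qed.

Lemma row_colour_noncrossing (s t : nat) :
  2 < s -> 2 < t -> odd s -> odd t ->
  noncrossing_grid s t (mirror1 t) by_row (row_colour s t).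
Proof. by move=> s3 t3 s_odd t_odd; prove_noncrossing by_rowW. Qed.

Lemma ladder_colour_proper (s t : nat) :
  2 < s -> 2 < t -> ~~ odd s -> odd t ->
  proper_grid s t (mirror0 t) (ladder_colour s t).
Proof. by move=> s3 t3 s_even t_odd; prove_proper. Qed.

Lemma ladder_colour_noncrossing (s t : nat) :
  2 < s -> 2 < t -> ~~ odd s -> odd t ->
  noncrossing_grid s t (mirror0 t) ladder_first (ladder_colour s t).
Proof. by move=> s3 t3 s_even t_odd; prove_noncrossing ladder_firstW. Qed.

Lemma column_colour0_lt (s t : nat) (x : grid_edge) :
  column_colour0 s t x < if odd s then 5 else 4.
Proof. by case: x => *; rewrite /=; case: (odd s); lia. Qed.

Lemma column_colour1_lt (s t : nat) (x : grid_edge) :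
  column_colour1 s t x < if odd s then 4 else 5.
Proof.
by case: x => *; rewrite /=; case: (odd s) => //=; do ?case: ifP; lia.
Qed.

(** The parity of [phi o] separates reflections without fixed labels ([mirror1]) from those with two
    ([mirror0]). *)
Lemma cycle_bundle_embedding_even (s t : nat) (phi : {perm 'I_t}) (o : 'I_t) :
  2 < s -> 2 < t -> reflection phi -> o = 0 :> nat -> ~~ odd t ->
  has_matching_book_embedding (@cycle_bundle s t phi)
    (if odd s == odd (phi o) then 4 else 5).
Proof.
move=> s3 t3 hphi o0 t_even; have [irr trans total] := by_column_order.
have [c_odd|c_even] := boolP (odd (phi o)).
  have [|r rt rE] := mirror1_shift hphi o0; first by rewrite c_odd orbT.
  apply: (bundle_embedding t3 rt rE irr trans total _
    (column_colour1_proper s3 t3 t_even)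
    (column_colour1_noncrossing s3 t3 t_even)).
  by move=> x; apply: leq_trans (column_colour1_lt s t x) _; case: (odd s).
have [|r rt rE] := mirror0_shift hphi o0; first by rewrite c_even orbT.
apply: (bundle_embedding t3 rt rE irr trans total _
  (column_colour0_proper s3 t3 t_even)
  (column_colour0_noncrossing s3 t3 t_even)).
move=> x; apply: leq_trans (column_colour0_lt s t x) _.
by case: (odd s).
Qed.

(** For [t] odd both mirrors are available, and the parity of [s] selects the layout. *)
Lemma cycle_bundle_embedding_odd (s t : nat) (phi : {perm 'I_t}) (o : 'I_t) :
  2 < s -> 2 < t -> reflection phi -> o = 0 :> nat -> odd t ->
  has_matching_book_embedding (@cycle_bundle s t phi) 5.
Proof.
move=> s3 t3 hphi o0 t_odd; have [s_odd|s_even] := boolP (odd s).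
  have [irr trans total] := by_row_order.
  have [|r rt rE] := mirror1_shift hphi o0; first by rewrite t_odd.
  apply: (bundle_embedding t3 rt rE irr trans total _
    (row_colour_proper s3 t3 s_odd t_odd)
    (row_colour_noncrossing s3 t3 s_odd t_odd)).
  by case=> *; rewrite /=; do ?case: ifP; lia.
have [irr trans total] := ladder_first_order.
have [|r rt rE] := mirror0_shift hphi o0; first by rewrite t_odd.
apply: (bundle_embedding t3 rt rE irr trans total _
  (ladder_colour_proper s3 t3 s_even t_odd)
  (ladder_colour_noncrossing s3 t3 s_even t_odd)).
by case=> *; rewrite /=; do ?case: ifP; lia.
Qed.

(** * The two values of the thickness *)

Lemma mbt_eq (T : finType) (e : rel T) (m : nat) :
  has_matching_book_embedding e m ->
  (forall n, has_matching_book_embedding e n -> m <= n) -> mbt e = m.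
Proof.
move=> em min; rewrite /mbt; case: ex_minnP => n en n_min.
by apply/eqP; rewrite eqn_leq n_min // min.
Qed.

Theorem theorem4p1 (s t : nat) (phi : {perm 'I_t})
    (hs : 3 <= s) (ht : 3 <= t) (hphi : reflection phi) :
  (bipartite (@cycle_bundle s t phi) -> mbt (@cycle_bundle s t phi) = 4) /\
  (~ bipartite (@cycle_bundle s t phi) -> mbt (@cycle_bundle s t phi) = 5).
Proof.
have t_gt0 : 0 < t by lia.
pose o := Ordinal t_gt0; have o0 : o = 0 :> nat by [].
have e_sym := @cycle_bundle_sym s t phi.
have e_irr := @cycle_bundle_irrefl s t phi hs ht.
have s_gt0 : 0 < s by lia.
have ge4 n : has_matching_book_embedding (@cycle_bundle s t phi) n -> 4 <= n.
  move/(degree_le_matching_book_embedding (Ordinal s_gt0, o) e_sym).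
  exact: leq_trans (cycle_bundle_degree _ _ hs ht).
split=> [bip|nbip]; apply: mbt_eq => //.
- have [t_even s_phi] := bipartite_cycle_bundle hs ht o0 bip.
  have := cycle_bundle_embedding_even hs ht hphi o0 t_even.
  by rewrite s_phi eqxx.
- have [t_odd|t_even] := boolP (odd t).
    exact: (cycle_bundle_embedding_odd hs ht hphi o0 t_odd).
  have := cycle_bundle_embedding_even hs ht hphi o0 t_even.
  (* If the parities agreed, the embedding would have four pages and force bipartiteness. *)
  case: ifP => // _ e4; case: nbip.
  apply: (bipartite_of_matching_book_embedding e_sym e_irr _ e4) => u.
  exact: cycle_bundle_degree.
- move=> n en; rewrite ltn_neqAle ge4 // andbT; apply/eqP=> n4.
  rewrite -n4 in en; apply: nbip.
  apply: (bipartite_of_matching_book_embedding e_sym e_irr _ en) => u.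
  exact: cycle_bundle_degree.
Qed.
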